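(* There exists a set $\mathcal Z\subset\mathbb R^{Tp}$ with $|\mathcal Z|\le16\pi(Tp)^{3/2}$ such that $\|z\|_\infty\le1$ for all $z\in\mathcal Z$ and $\|\bar v\|_\ominus\le4\max_{z\in\mathcal Z}z^\top\bar v$ for all $\bar v\in\mathbb R^{Tp}$.
   Context: For $\bar v=[v_1^\top,\dots,v_T^\top]^\top\in\mathbb R^{Tp}$ ($v_i\in\mathbb R^p$) and a fixed number of rows $R\ge1$, $\mathsf{Toep}_T(\bar v)$ is the $R\times(R+T-1)$ block matrix with $1\times p$ blocks whose $i$-th block row has $v_T^\top,v_{T-1}^\top,\dots,v_1^\top$ in block columns $i,\dots,i+T-1$ and zeros elsewhere; $\|\bar v\|_\ominus:=\|\mathsf{Toep}_T(\bar v)\|_{\mathrm{op}}$. *)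

(* Defs.v *)
From HB Require Import structures.
From mathcomp Require Import all_boot all_order all_algebra.
From mathcomp Require Import all_classical all_reals all_analysis.
Set Implicit Arguments. Unset Strict Implicit. Unset Printing Implicit Defensive.
Import Order.TTheory GRing.Theory Num.Theory.
Local Open Scope ring_scope.

Section Toep.
Local Set Implicit Arguments.
Variable R : realType.

Definition norm2 (n : nat) (x : 'cV[R]_n) : R := Num.sqrt (\sum_i (x i 0) ^+ 2).

Definition opnorm (a b : nat) (M : 'M[R]_(a, b)) : R :=
  sup [set norm2 (M *m x) | x in [set x : 'cV[R]_b | norm2 x <= 1]]%classic.

Definition coord0 (n : nat) (v : 'cV[R]_n) (k : nat) : R :=
  oapp (fun i : 'I_n => v i 0) 0 (insub k).

(* Toep_T(vbar) with m rows, for vbar = [v_1; ...; v_T], v_i in R^p stored at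
   coordinates (i-1)p .. ip-1.  Row i (0-indexed) has, in block column j with
   i <= j < i+T, the block v_{T-(j-i)}^T (1-indexed), i.e. coordinates
   (T-1-(j-i))p + k, k < p. *)
Definition toep (m T p : nat) (v : 'cV[R]_(T * p)) : 'M[R]_(m, (m + T - 1) * p) :=
  \matrix_(i < m, c < (m + T - 1) * p)
    if ((i <= c %/ p) && (c %/ p < i + T))%N
    then coord0 v ((T - 1 - (c %/ p - i)) * p + c %% p)%N
    else 0.

Definition toep_norm (m T p : nat) (v : 'cV[R]_(T * p)) : R := opnorm (@toep m T p v).
End Toep.
Arguments toep {R} m T p v.
Arguments toep_norm {R} m T p v.

(* Main.v *)
Require Import Defs.
From HB Require Import structures.
From mathcomp Require Import all_boot all_order all_algebra.
From mathcomp Require Import all_classical all_reals all_analysis.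
From mathcomp Require Import ring lra zify.
Import Order.TTheory GRing.Theory Num.Theory.
Import numFieldNormedType.Exports.
Local Open Scope ring_scope.

(** Put n = T p and f(t) = sum_(l < n) v_l e^(i l t), so that [power] below is
    |f(t)|^2.  After reindexing columns, the block Toeplitz matrix is a submatrix
    of the scalar convolution matrix of v, so a discrete Fourier transform on a
    long cyclic group bounds its norm by max |f|.  On a uniform grid of
    N ~ 8 n^(3/2) points, Parseval gives |v|_2 <= M, where M is the maximum of
    |f| on the grid, and Cauchy-Schwarz gives |f(t) - f(s)| <= n^(3/2) |v|_2 |t - s|;
    hence |f| is at most a constant times M everywhere.  Finally
    M <= sqrt 2 max(|Re f|, |Im f|) at the best grid point, and +-Re f, +-Im f
    there are inner products of v with cosine and sine vectors: these 4N vectors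
    form Z. *)

Section TrigSums.
Variable R : realType.

(** * Elementary inequalities: sine, chords of the circle, finite sums *)

Lemma sin_norm_le (x : R) : `|sin x| <= `|x|.
Proof.
wlog x0 : x / 0 < x => [H|].
  case: (ltgtP x 0) => [xlt|xgt|->]; last by rewrite sin0.
    by rewrite -normrN -sinN -(normrN x); apply: H; rewrite oppr_gt0.
  exact: H.
have [|c _] := @MVT R sin cos 0 x x0 (fun y _ => is_derive_sin y).
  exact/continuous_subspaceT/continuous_sin.
rewrite sin0 !subr0 => ->; rewrite normrM ler_piMl ?normr_ge0 //.
exact: cos_max.
Qed.

(** The squared chord between two points of the unit circle is [4 * sin ((x - y) / 2) ^+ 2]. *)
Lemma chord_sqr_le (x y : R) :
  (cos x - cos y) ^+ 2 + (sin x - sin y) ^+ 2 <= (x - y) ^+ 2.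
Proof.
have -> : (cos x - cos y) ^+ 2 + (sin x - sin y) ^+ 2 =
          4 * sin ((x - y) / 2) ^+ 2.
  have -> : sin ((x - y) / 2) ^+ 2 = (1 - cos (x - y)) / 2.
    have {2}-> : x - y = ((x - y) / 2) *+ 2 by rewrite mulr2n; field.
    by rewrite cos_mulr2n cos2sin2; field.
  rewrite cosB; have := cos2Dsin2 x; have := cos2Dsin2 y; nra.
have := sin_norm_le ((x - y) / 2); rewrite -(ler_pXn2r (ltn0Sn 1)) ?nnegrE //.
rewrite !real_normK ?num_real // expr_div_n; lra.
Qed.

(** Lagrange's identity: the gap is half of a double sum of squares. *)
Lemma cauchy_schwarz_sum (I : finType) (a b : I -> R) :
  (\sum_i a i * b i) ^+ 2 <= (\sum_i a i ^+ 2) * (\sum_i b i ^+ 2).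
Proof.
have : 0 <= \sum_i \sum_j (a i * b j - a j * b i) ^+ 2.
  by apply: sumr_ge0 => i _; apply: sumr_ge0 => j _; exact: sqr_ge0.
have -> : \sum_i \sum_j (a i * b j - a j * b i) ^+ 2 =
   2 * ((\sum_i a i ^+ 2) * (\sum_i b i ^+ 2) - (\sum_i a i * b i) ^+ 2).
  transitivity (\sum_i \sum_j (a i ^+ 2 * b j ^+ 2)
    + \sum_i \sum_j (a j ^+ 2 * b i ^+ 2)
    - 2 * \sum_i \sum_j ((a i * b i) * (a j * b j))).
    rewrite mulr_sumr -sumrN -!big_split /=; apply: eq_bigr => i _.
    rewrite mulr_sumr -sumrN -!big_split /=; apply: eq_bigr => j _; ring.
  rewrite [X in _ + X - _]exchange_big /= expr2 !big_distrlr /=; ring.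
by rewrite pmulr_rge0 // subr_ge0.
Qed.

(** * Trigonometric sums on a grid: orthogonality, Parseval, convolution *)

Definition cos_sum {I : finType} (a : I -> nat) (w : I -> R) (t : R) : R :=
  \sum_i w i * cos ((a i)%:R * t).

Definition sin_sum {I : finType} (a : I -> nat) (w : I -> R) (t : R) : R :=
  \sum_i w i * sin ((a i)%:R * t).

Definition power {I : finType} (a : I -> nat) (w : I -> R) (t : R) : R :=
  cos_sum a w t ^+ 2 + sin_sum a w t ^+ 2.

Definition grid (L q : nat) : R := pi *+ 2 * q%:R / L%:R.

(** Each product [2 * sin (h / 2) * cos (q * h)] is the difference of the sines of [(q + 1/2) h] and
    [(q - 1/2) h]. *)
Lemma sum_cos_telescope (n : nat) (h : R) :
  (\sum_(q < n) cos (q%:R * h)) * (2 * sin (h / 2)) =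
  sin (n%:R * h - h / 2) + sin (h / 2).
Proof.
elim: n => [|n IH].
  by rewrite big_ord0 !mul0r sub0r sinN addNr.
rewrite big_ord_recr /= mulrDl IH -[n.+1%:R]natr1.
have -> : (n%:R + 1) * h - h / 2 = n%:R * h + h / 2 by field.
rewrite sinB sinD; ring.
Qed.

Lemma sum_cos_grid_lt (L d : nat) : (0 < d < L)%N ->
  \sum_(q < L) cos (d%:R * grid L q) = 0.
Proof.
move=> /andP[d0 dL].
have L0 : 0 < L%:R :> R by rewrite ltr0n; apply: leq_trans dL.
have Ln0 : L%:R != 0 :> R by rewrite gt_eqF.
set h : R := pi *+ 2 * d%:R / L%:R.
rewrite (eq_bigr (fun q : 'I_L => cos (q%:R * h))); last first.
  by move=> q _; congr cos; rewrite /grid /h; field.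
have := sum_cos_telescope L h.
(* Since [L h = 2 pi d], the telescoped side vanishes; [0 < h / 2 < pi] then makes [sin (h / 2)]
   nonzero. *)
have -> : L%:R * h - h / 2 = - (h / 2) + (pi *+ 2) *+ d.
  by rewrite /h -[_ *+ d]mulr_natr; field.
rewrite (periodicn (@sinD2pi R)) sinN addNr => /eqP.
rewrite !mulf_eq0 => /or3P[/eqP //||]; first by rewrite pnatr_eq0.
suff /gt_eqF -> : 0 < sin (h / 2) by [].
apply: sin_gt0_pi.
have -> : h / 2 = pi * (d%:R / L%:R) by rewrite /h mulr2n; field.
have d0' : 0 < d%:R :> R by rewrite ltr0n.
rewrite mulr_gt0 ?pi_gt0 ?divr_gt0 //=.
by rewrite gtr_pMr ?pi_gt0 // ltr_pdivrMr // mul1r ltr_nat.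
Qed.

Lemma sum_cos_grid (L a b : nat) : (a < L)%N -> (b < L)%N ->
  \sum_(q < L) cos ((a%:R - b%:R) * grid L q) = L%:R * (a == b)%:R.
Proof.
move=> aL bL; case: (ltngtP a b) => [ab|ba|->].
- rewrite mulr0; apply: etrans (@sum_cos_grid_lt L (b - a) _); last by lia.
  apply: eq_bigr => q _; rewrite natrB ?(ltnW ab) //.
  by rewrite -cosN -mulNr opprB.
- rewrite mulr0; apply: etrans (@sum_cos_grid_lt L (a - b) _); last by lia.
  by apply: eq_bigr => q _; rewrite natrB ?(ltnW ba).
rewrite mulr1 (eq_bigr (fun=> 1)); last by move=> q _; rewrite subrr mul0r cos0.
by rewrite sumr_const card_ord.
Qed.

Lemma powerE (I : finType) (a : I -> nat) (w : I -> R) t :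
  power a w t = \sum_i \sum_j w i * w j * cos (((a i)%:R - (a j)%:R) * t).
Proof.
rewrite /power /cos_sum /sin_sum !expr2 !big_distrlr /= -big_split /=.
apply: eq_bigr => i _; rewrite -big_split /=; apply: eq_bigr => j _.
rewrite mulrBl cosB; ring.
Qed.

(** The frequencies are distinct and below [L], so the off-diagonal terms of the expanded square sum
    to zero over the grid. *)
Lemma parseval_grid (I : finType) (a : I -> nat) (w : I -> R) (L : nat) :
  injective a -> (forall i, a i < L)%N ->
  \sum_(q < L) power a w (grid L q) = L%:R * \sum_i w i ^+ 2.
Proof.
move=> inja aL; under eq_bigr do rewrite powerE.
rewrite exchange_big mulr_sumr /=; apply: eq_bigr => i _.
rewrite exchange_big (bigD1 i) //= [X in _ + X]big1 => [|j ji].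
  by rewrite -mulr_sumr sum_cos_grid // eqxx mulr1 addr0; ring.
by rewrite -mulr_sumr sum_cos_grid // inj_eq // eq_sym (negPf ji) !mulr0.
Qed.

(** If [F], [X], [U] are the complex exponential sums of [w], [x], [u], the left side is the real
    part of [F X conj(U)]. *)
Lemma cos_sum_conv (I J K : finType) (a : I -> nat) (b : J -> nat) (c : K -> nat)
    (w : I -> R) (x : J -> R) (u : K -> R) t :
  (cos_sum a w t * cos_sum b x t - sin_sum a w t * sin_sum b x t) * cos_sum c u t
  + (cos_sum a w t * sin_sum b x t + sin_sum a w t * cos_sum b x t) * sin_sum c u t
  = \sum_k \sum_j \sum_i
      u k * x j * w i * cos (((a i + b j)%:R - (c k)%:R) * t).
Proof.
transitivity (\sum_k \sum_j u k * x j *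
    (cos_sum a w t * cos (((b j)%:R - (c k)%:R) * t)
     - sin_sum a w t * sin (((b j)%:R - (c k)%:R) * t))); last first.
  apply: eq_bigr => k _; apply: eq_bigr => j _; rewrite /cos_sum /sin_sum.
  rewrite !mulr_suml -sumrN -big_split mulr_sumr /=; apply: eq_bigr => i _.
  by rewrite natrD -addrA (mulrDl (a i)%:R) cosD; ring.
move: (cos_sum a w t) (sin_sum a w t) => A1 A2.
transitivity (\sum_k u k *
    ((A1 * cos_sum b x t - A2 * sin_sum b x t) * cos ((c k)%:R * t)
     + (A1 * sin_sum b x t + A2 * cos_sum b x t) * sin ((c k)%:R * t))); last first.
  apply: eq_bigr => k _; rewrite /cos_sum /sin_sum.
  rewrite !mulr_sumr -sumrN -!big_split /= !mulr_suml -big_split mulr_sumr /=.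
  by apply: eq_bigr => j _; rewrite ![(_ - _) * t]mulrBl cosB sinB; ring.
move: (A1 * cos_sum b x t - _) (A1 * sin_sum b x t + _) => P1 P2.
rewrite /cos_sum /sin_sum.
by rewrite !mulr_sumr -big_split /=; apply: eq_bigr => k _; ring.
Qed.

(** The indicator is a grid average of cosines, without wraparound because [a i + b j < L].
    Pointwise, [2 Re(F X conj(U)) <= M (|X|^2 + |U|^2)], and Parseval sums the right side. *)
Lemma conv_form_le (I J K : finType) (a : I -> nat) (b : J -> nat) (c : K -> nat)
    (w : I -> R) (x : J -> R) (u : K -> R) (L : nat) (M : R) :
  injective b -> injective c ->
  (forall i j, a i + b j < L)%N -> (forall j, b j < L)%N -> (forall k, c k < L)%N ->
  (0 < L)%N -> 0 <= M -> (forall q : 'I_L, power a w (grid L q) <= M ^+ 2) ->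
  2 * (\sum_k \sum_j \sum_i u k * x j * w i * (a i + b j == c k)%N%:R)
  <= M * (\sum_j x j ^+ 2 + \sum_k u k ^+ 2).
Proof.
move=> injb injc abL bL cL L0 M0 wM.
have L0' : 0 < L%:R :> R by rewrite ltr0n.
rewrite -(ler_pM2l L0') [leRHS]mulrCA mulrDr.
rewrite -(parseval_grid _ b) // -(parseval_grid _ c) //.
have -> : L%:R *
    (2 * (\sum_k \sum_j \sum_i u k * x j * w i * (a i + b j == c k)%N%:R)) =
  \sum_(q < L) 2 * (\sum_k \sum_j \sum_i
      u k * x j * w i * cos (((a i + b j)%:R - (c k)%:R) * grid L q)).
  rewrite -[RHS]mulr_sumr mulrCA; congr (_ * _).
  rewrite [RHS]exchange_big mulr_sumr /=; apply: eq_bigr => k _.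
  rewrite [RHS]exchange_big mulr_sumr /=; apply: eq_bigr => j _.
  rewrite [RHS]exchange_big mulr_sumr /=; apply: eq_bigr => i _.
  by rewrite -[RHS]mulr_sumr sum_cos_grid //; ring.
rewrite -big_split mulr_sumr /=; apply: ler_sum => q _.
rewrite -cos_sum_conv; move: (wM q); rewrite /power.
move: (cos_sum a _ _) (sin_sum a _ _) (cos_sum b _ _) (sin_sum b _ _)
  (cos_sum c _ _) (sin_sum c _ _) => F1 F2 X1 X2 U1 U2 FM.
set P1 := F1 * X1 - F2 * X2; set P2 := F1 * X2 + F2 * X1.
have PM : P1 ^+ 2 + P2 ^+ 2 <= M ^+ 2 * (X1 ^+ 2 + X2 ^+ 2).
  have -> : P1 ^+ 2 + P2 ^+ 2 = (F1 ^+ 2 + F2 ^+ 2) * (X1 ^+ 2 + X2 ^+ 2).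
    by rewrite /P1 /P2; ring.
  by rewrite ler_wpM2r // addr_ge0 ?sqr_ge0.
(* The case [M = 0] is split off because completing the squares [|P - M U|^2] requires multiplying
   the goal by [M]. *)
clearbody P1 P2; move: M0; rewrite le_eqVlt => /predU1P[M0|M0].
  move: PM; rewrite -M0 expr0n /= !mul0r => PM.
  have P10 : P1 = 0 by nra.
  have P20 : P2 = 0 by nra.
  by rewrite P10 P20; lra.
rewrite -(ler_pM2l M0).
have := sqr_ge0 (P1 - M * U1); have := sqr_ge0 (P2 - M * U2); nra.
Qed.

(** * From one grid to another *)

Lemma power_lipschitz (I : finType) (a : I -> nat) (w : I -> R) (n : nat) s t :
  (forall i, a i <= n)%N ->
  power a w t <= 2 * power a w s
    + 2 * ((\sum_i w i ^+ 2) * (#|I|%:R * n%:R ^+ 2 * (t - s) ^+ 2)).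
Proof.
move=> an.
set dC := fun i => cos ((a i)%:R * t) - cos ((a i)%:R * s).
set dS := fun i => sin ((a i)%:R * t) - sin ((a i)%:R * s).
have eC : cos_sum a w t = cos_sum a w s + \sum_i w i * dC i.
  rewrite /cos_sum -big_split /=; apply: eq_bigr => i _; rewrite /dC; ring.
have eS : sin_sum a w t = sin_sum a w s + \sum_i w i * dS i.
  rewrite /sin_sum -big_split /=; apply: eq_bigr => i _; rewrite /dS; ring.
have W0 : 0 <= \sum_i w i ^+ 2 by apply: sumr_ge0 => i _; exact: sqr_ge0.
have dB : \sum_i dC i ^+ 2 + \sum_i dS i ^+ 2 <= #|I|%:R * n%:R ^+ 2 * (t - s) ^+ 2.
  rewrite -big_split /= -mulrA mulr_natl -sumr_const; apply: ler_sum => i _.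
  apply: (le_trans (chord_sqr_le _ _)); rewrite -mulrBr exprMn ler_wpM2r ?sqr_ge0 //.
  by rewrite ler_pXn2r ?nnegrE ?ler0n // ler_nat.
have := ler_wpM2l W0 dB; rewrite mulrDr.
have := cauchy_schwarz_sum _ w dC; have := cauchy_schwarz_sum _ w dS.
rewrite /power eC eS.
move: (cos_sum _ _ _) (sin_sum _ _ _) (\sum_i w i * dC i) (\sum_i w i * dS i).
move=> C S D E hE hD h.
(* This is [|F + G|^2 <= 2 |F|^2 + 2 |G|^2], with [G] the increment from [s] to [t]. *)
have := sqr_ge0 (C - D); have := sqr_ge0 (S - E); lra.
Qed.

Lemma grid_approx (L N : nat) (q : 'I_L) : (0 < N)%N ->
  exists r : 'I_N, (grid L q - grid N r) ^+ 2 <= (pi *+ 2 / N%:R) ^+ 2.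
Proof.
move=> N0; have L0 : (0 < L)%N by apply: leq_trans (ltn_ord q).
have rN : (q * N %/ L < N)%N by rewrite ltn_divLR // mulnC ltn_pmul2l.
(* Rounding [q N / L] down costs at most one step of the [N]-point grid. *)
exists (Ordinal rN) => /=; rewrite /grid /=.
have L0' : 0 < L%:R :> R by rewrite ltr0n.
have N0' : 0 < N%:R :> R by rewrite ltr0n.
set r := (q * N %/ L)%N.
have -> : pi *+ 2 * q%:R / L%:R - pi *+ 2 * r%:R / N%:R =
  pi *+ 2 / N%:R * ((q * N)%:R / L%:R - r%:R) :> R.
  by rewrite natrM; field; rewrite !gt_eqF.
rewrite exprMn ler_piMr ?sqr_ge0 //.
have lo : r%:R <= (q * N)%:R / L%:R :> R.
  by rewrite ler_pdivlMr // -natrM ler_nat leq_divM.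
have hi : (q * N)%:R / L%:R <= r%:R + 1 :> R.
  by rewrite ler_pdivrMr // natr1 -natrM ler_nat ltnW // ltn_ceil.
nra.
Qed.

Lemma power_le_grid_max (n N L : nat) (w : 'I_n -> R) (M : R) :
  (0 < n)%N -> (n <= N)%N -> 49 * n%:R ^+ 3 <= N%:R ^+ 2 :> R ->
  (forall r : 'I_N, power (@nat_of_ord n) w (grid N r) <= M) ->
  forall q : 'I_L, power (@nat_of_ord n) w (grid L q) <= 8 * M.
Proof.
move=> n0 nN hN hM q; have N0 : (0 < N)%N by exact: leq_trans nN.
have N0' : 0 < N%:R :> R by rewrite ltr0n.
(* By Parseval this sum is the mean of [power] over the [N]-point grid. *)
have W : \sum_i w i ^+ 2 <= M.
  rewrite -(ler_pM2l N0') -(@parseval_grid _ (@nat_of_ord n)).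
  - by rewrite -[N in leRHS]card_ord mulr_natl -sumr_const; apply: ler_sum => r _.
  - exact: val_inj.
  - by move=> i; exact: leq_trans (ltn_ord i) nN.
have [r hr] := grid_approx L N q N0.
apply: le_trans (@power_lipschitz _ _ w n (grid N r) _ _) _.
  by move=> i; exact: ltnW.
rewrite card_ord; move: hr; set d := (_ - _) ^+ 2 => hr.
(* The crude bound [pi < 4] gives [d N^2 <= 64], and [64 / 49 < 3 / 2]. The final total is then
   [2 M + 3 M], within [8 M]. *)
have nd : n%:R * n%:R ^+ 2 * d <= 3 / 2.
  have {}hr : d * N%:R ^+ 2 <= 64.
    apply: (le_trans (ler_wpM2r (sqr_ge0 _) hr)).
    rewrite -exprMn divfK ?gt_eqF // mulr2n.
    have := pi_ge0 R; have := pihalf_lt2 R; nra.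
  have d0 : 0 <= d by exact: sqr_ge0.
  have := ler_wpM2r d0 hN; rewrite -exprS; lra.
have W0 : 0 <= \sum_i w i ^+ 2 by apply: sumr_ge0 => i _; exact: sqr_ge0.
have := ler_wpM2l W0 nd; have := hM r; lra.
Qed.

End TrigSums.

Arguments cos_sum {R I} a w t.
Arguments sin_sum {R I} a w t.
Arguments power {R I} a w t.

(** * The block Toeplitz matrix as a scalar convolution *)

Section ToepNorm.
Variable R : realType.

Lemma coord0E (n : nat) (v : 'cV[R]_n) (k : nat) :
  Defs.coord0 v k = \sum_l v l 0 * (l == k :> nat)%:R.
Proof.
rewrite /Defs.coord0; case: insubP => [l _ <-|kn] /=.
  rewrite (bigD1 l) //= eqxx mulr1 big1 ?addr0 // => j jl.
  by rewrite (inj_eq val_inj) (negPf jl) mulr0.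
rewrite big1 // => l _; rewrite ltn_eqF ?mulr0 //.
by apply: (leq_trans (ltn_ord l)); rewrite leqNgt.
Qed.

(** Each block of columns is reversed in place: a Toeplitz row lists the blocks of [v] backwards but
    each block forwards, while a convolution reads every coordinate backwards. *)
Definition col_pos (p c : nat) : nat := ((c %/ p).+1 * p - c %% p)%N.

Lemma col_pos_inj (p : nat) : (0 < p)%N -> injective (col_pos p).
Proof.
move=> p0 c c'; rewrite /col_pos.
rewrite {3}(divn_eq c p) {3}(divn_eq c' p).
move: (ltn_pmod c p0) (ltn_pmod c' p0).
move: (c %/ p)%N (c %% p)%N (c' %/ p)%N (c' %% p)%N => j k j' k' kp kp' H.
have jj : j = j' by nia.
by subst j'; congr (_ + _)%N; nia.
Qed.

(* Placing column [c] at position [col_pos p c] and row [i] at [(T + i) * p]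
   makes the block Toeplitz matrix a submatrix of the matrix of the scalar
   convolution with [v]. *)
Lemma toep_convE (m T p : nat) (v : 'cV[R]_(T * p)) i c : (0 < T)%N -> (0 < p)%N ->
  toep m T p v i c = \sum_l v l 0 * (l + col_pos p c == (T + i) * p)%N%:R.
Proof.
move=> T0 p0; rewrite mxE /col_pos; have := ltn_pmod c p0.
move: (c %/ p)%N (c %% p)%N => j k kp.
case: ifPn => [/andP[ij jiT]|out].
  rewrite coord0E; apply: eq_bigr => l _; congr (_ * (nat_of_bool _)%:R).
  (* Naming the differences [s] and [r] removes the truncated subtractions. *)
  have [s js] : exists s, j = (i + s)%N by exists (j - i)%N; lia.
  have [r Tr] : exists r, T = (s + r).+1 by exists (T - s.+1)%N; lia.
  have -> : (T - 1 - (j - i) = r)%N by lia.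
  rewrite js; move: (nat_of_ord l) => l'; rewrite Tr.
  apply/eqP/eqP; nia.
(* Outside the band the equation would force [l] to be negative or at least [T * p]. *)
rewrite big1 // => l _; case: eqP => [|_]; last by rewrite mulr0.
have := ltn_ord l; move: out; rewrite negb_and -!leqNgt -ltnNge => /orP[h|h] hl; nia.
Qed.

Lemma norm2_sqr (n : nat) (x : 'cV[R]_n) : norm2 x ^+ 2 = \sum_i x i 0 ^+ 2.
Proof. by rewrite sqr_sqrtr // sumr_ge0 // => i _; exact: sqr_ge0. Qed.

(** By duality, [norm2 y] is the convolution form tested against the unit vector [u = y / norm2 y].
    The cyclic length [(m + 2 * T) * p] exceeds every position sum that occurs. *)
Lemma toep_norm_le (m T p : nat) (v : 'cV[R]_(T * p)) (M : R) :
  (0 < T)%N -> (0 < p)%N -> 0 <= M ->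
  (forall q : 'I_((m + 2 * T) * p),
     power (@nat_of_ord _) (v^~ 0) (grid R ((m + 2 * T) * p) q) <= M ^+ 2) ->
  toep_norm m T p v <= M.
Proof.
move=> T0 p0 M0 hM; apply: ge_sup.
  exists (norm2 (toep m T p v *m 0)), 0 => //=.
  by rewrite /norm2 big1 ?sqrtr0 // => i _; rewrite mxE expr0n.
move=> _ [x /= x1 <-]; set y := _ *m x.
have y0 : 0 <= norm2 y by exact: sqrtr_ge0.
have [ypos|] := ltP 0 (norm2 y); last by move/le_trans; apply.
have x1' : \sum_i x i 0 ^+ 2 <= 1.
  by rewrite -norm2_sqr expr_le1 // sqrtr_ge0.
pose u i := y i 0 / norm2 y.
have u1 : \sum_i u i ^+ 2 = 1.
  under eq_bigr do rewrite /u expr_div_n.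
  by rewrite -mulr_suml -norm2_sqr divff // sqrf_eq0 gt_eqF.
have := @conv_form_le R _ _ _ (@nat_of_ord (T * p))
  (fun c : 'I_((m + T - 1) * p) => col_pos p c) (fun i : 'I_m => ((T + i) * p)%N)
  (v^~ 0) (x^~ 0) u ((m + 2 * T) * p)%N M.
have dL (c : 'I_((m + T - 1) * p)) : (col_pos p c <= (m + T - 1) * p)%N.
  rewrite /col_pos; apply: (leq_trans (leq_subr _ _)).
  by rewrite leq_pmul2r // ltn_divLR.
rewrite u1.
have -> : \sum_k \sum_j \sum_i u k * x j 0 * v i 0
    * (i + col_pos p j == (T + k) * p)%N%:R = norm2 y.
  transitivity (\sum_k u k * y k 0).
    apply: eq_bigr => k _; rewrite mxE mulr_sumr; apply: eq_bigr => j _.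
    by rewrite toep_convE // mulr_suml mulr_sumr; apply: eq_bigr => i _; ring.
  under eq_bigr do rewrite /u mulrAC -expr2.
  by rewrite -mulr_suml -norm2_sqr expr2 mulfK ?gt_eqF.
(* The right side is at most [2 M], as [x] lies in the unit ball. *)
move=> H; suff : 2 * norm2 y <= M * (\sum_i x i 0 ^+ 2 + 1) by nra.
apply: H => //.
- by move=> c c' /(col_pos_inj _ p0) /val_inj.
- by move=> i i' /eqP; rewrite eqn_pmul2r // eqn_add2l => /eqP /val_inj.
- by move=> i j; have := dL j; have := ltn_ord i; nia.
- by move=> j; have := dL j; nia.
- by move=> k; rewrite ltn_pmul2r //; have := ltn_ord k; lia.
- by nia.
Qed.

Lemma powR_3half_sqr (n : nat) : ((n%:R : R) `^ (3 / 2)) ^+ 2 = n%:R ^+ 3.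
Proof.
by rewrite -!powR_mulrn ?powR_ge0 // -powRrM divfK.
Qed.

End ToepNorm.

Theorem lemma11 (R : realType) (m T p : nat) :
  (0 < m)%N -> (0 < T)%N -> (0 < p)%N ->
  exists Z : seq 'cV[R]_(T * p),
    (size (undup Z))%:R <= 16 * pi * (((T * p)%:R : R) `^ (3 / 2)) /\
    (forall z, z \in Z -> forall i, `|z i 0| <= 1) /\
    (forall v : 'cV[R]_(T * p),
        exists2 z, z \in Z & toep_norm m T p v <= 4 * (z^T *m v) 0 0).
Proof.
move=> m0 T0 p0; set n := (T * p)%N.
have n0 : (0 < n)%N by rewrite muln_gt0 T0.
set P := (n%:R : R) `^ (3 / 2).
have P2 : P ^+ 2 = n%:R ^+ 3 := powR_3half_sqr R n.
have P0 : 0 <= P := powR_ge0 _ _.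
have n1 : 1 <= n%:R :> R by rewrite ler1n.
have nP : n%:R <= P.
  by rewrite -(@ler_pXn2r _ 2) ?nnegrE ?ler0n // P2 ler_weXn2l.
(* As [P >= 1], rounding down leaves [N >= 7 P], whence the constant [49]; and
   [4 N <= 32 P <= 16 pi P] because [pi >= 2]. *)
pose N := Num.truncn (8 * P).
have /andP[NP PN] : N%:R <= 8 * P < N.+1%:R by apply: truncn_itv; rewrite mulr_ge0.
have N7 : 7 * P <= N%:R by move: PN; rewrite -natr1; lra.
have nN : (n <= N)%N by rewrite -(ler_nat R); lra.
have hN : 49 * n%:R ^+ 3 <= N%:R ^+ 2 :> R.
  by rewrite -P2; nra.
pose C (q : 'I_N) : 'cV[R]_n := \col_l cos (l%:R * grid R N q).
pose S (q : 'I_N) : 'cV[R]_n := \col_l sin (l%:R * grid R N q).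
pose Z := codom C ++ codom S ++ codom (fun q => - C q) ++ codom (fun q => - S q).
exists Z; split; [|split].
- apply: (@le_trans _ _ (size Z)%:R); first by rewrite ler_nat size_undup.
  rewrite /Z !size_cat !size_codom !card_ord !natrD.
  by have := pi_ge2 R; nra.
- move=> z; rewrite !mem_cat => /or4P[] /codomP[q ->] i; rewrite !mxE ?normrN;
    first [exact: cos_max | exact: sin_max].
move=> v.
have CE q : ((C q)^T *m v) 0 0 = cos_sum (@nat_of_ord n) (v^~ 0) (grid R N q).
  by rewrite mxE; apply: eq_bigr => l _; rewrite !mxE mulrC.
have SE q : ((S q)^T *m v) 0 0 = sin_sum (@nat_of_ord n) (v^~ 0) (grid R N q).
  by rewrite mxE; apply: eq_bigr => l _; rewrite !mxE mulrC.
pose F (q : 'I_N) := power (@nat_of_ord n) (v^~ 0) (grid R N q).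
have N0 : (0 < N)%N by exact: leq_trans nN.
have [q _ qmax] := @arg_maxP _ _ _ (Ordinal N0) xpredT F isT.
(* The factor [8] from the grid comparison times this [2] is [4 ^+ 2]. *)
have key z : F q <= 2 * ((z^T *m v) 0 0) ^+ 2 -> 0 <= (z^T *m v) 0 0 ->
    toep_norm m T p v <= 4 * (z^T *m v) 0 0.
  move=> Fz z0; apply: toep_norm_le => //; first by rewrite mulr_ge0.
  move=> r; apply: le_trans (@power_le_grid_max R n N _ _ (F q) n0 nN hN _ r) _.
    by move=> s; exact: qmax.
  by rewrite exprMn; lra.
have Cin : C q \in Z by rewrite !mem_cat codom_f.
have Sin : S q \in Z by rewrite !mem_cat codom_f orbT.
have NCin : - C q \in Z by rewrite !mem_cat (codom_f (fun q => - C q)) !orbT.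
have NSin : - S q \in Z by rewrite !mem_cat (codom_f (fun q => - S q)) !orbT.
have negE (z : 'cV[R]_n) : ((- z)^T *m v) 0 0 = - (z^T *m v) 0 0.
  by rewrite linearN mulNmx mxE.
have Fq : F q = ((C q)^T *m v) 0 0 ^+ 2 + ((S q)^T *m v) 0 0 ^+ 2.
  by rewrite CE SE.
(* The larger of the two squares is at least half of [F q]; the sign of [z] is then chosen to make
   the inner product nonnegative. *)
have [CS|SC] := lerP (((S q)^T *m v) 0 0 ^+ 2) (((C q)^T *m v) 0 0 ^+ 2).
- have [c0|c0] := lerP 0 (((C q)^T *m v) 0 0).
    by exists (C q) => //; apply: key => //; lra.
  by exists (- C q) => //; apply: key; rewrite negE ?sqrrN; lra.
have [s0|s0] := lerP 0 (((S q)^T *m v) 0 0).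
  by exists (S q) => //; apply: key => //; lra.
by exists (- S q) => //; apply: key; rewrite negE ?sqrrN; lra.
Qed.
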